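(* If $a$ and $c$ are integers, then $\underline{a}+\underline{c}\equiv\underline{a+c}$, where $\equiv$ denotes equivalence modulo $\mathbb{CR}_{SH}$.
   Context: Short cr-games (Cheating Robot games). The set $\mathbb{CR}$ of short cr-games (positions) is defined recursively. A position $G$ consists of a finite list $G(L)$ of $m\ge 0$ Left moves $G(i,\cdot)$, a finite list $G(R)$ of $n\ge 0$ Right moves $G(\cdot,j)$, and, for each $i$ a Left option $G^{i,\cdot}$, for each $j$ a Right option $G^{\cdot,j}$, and for each pair $(i,j)$ a same-round option $G^{i,j}$, all options being previously constructed positions. One writes $G=\{G^L\mid S(G)\mid G^R\}$, where $G^L$, $G^R$ are the lists of Left and Right options and $S(G)$ is the $m\times n$ matrix with entries $G^{i,j}$ ($S(G)=\emptyset$ if $m=0$ or $n=0$). The base case is $0=\{\,\cdot\mid\cdot\mid\cdot\,\}$ (no moves); a dot denotes an empty list. Outcomes. Play proceeds in rounds: from $G$, Left chooses a move $G(i,\cdot)$; then Right, knowing Left's choice, chooses $G(\cdot,j)$; the new position is $G^{i,j}$. If $S(G)=\emptyset$: $o(G)=\mathcal L$ (Left wins) if $G(L)\ne\emptyset$; $o(G)=\mathcal R$ (Right wins) if $G(R)\neq\emptyset$; otherwise $o(G)=\mathcal D$ (draw). If $S(G)\ne\emptyset$: $o(G)=\mathcal L$ if Left can force a win, $o(G)=\mathcal R$ if Right can force a win, otherwise $o(G)=\mathcal D$. Outcomes are totally ordered by $\mathcal L>\mathcal D>\mathcal R$. Disjunctive sum. $G+H$ has Left moves $G(i,\cdot)+H$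 and $G+H(k,\cdot)$ with Left options $G^{i,\cdot}+H$ and $G+H^{k,\cdot}$; Right moves $G(\cdot,j)+H$ and $G+H(\cdot,l)$ with Right options $G^{\cdot,j}+H$ and $G+H^{\cdot,l}$; and same-round options $G^{i,j}+H$ (both move in $G$), $G+H^{k,l}$ (both move in $H$), $G^{i,\cdot}+H^{\cdot,l}$ (Left in $G$, Right in $H$), $G^{\cdot,j}+H^{k,\cdot}$ (Left in $H$, Right in $G$). Integers. $\underline{0}=0$; for $n>0$, $\underline{n}=\{\underline{n-1}\mid\cdot\mid\cdot\,\}$; for $n<0$, $\underline{n}=\{\,\cdot\mid\cdot\mid\underline{n+1}\}$. Simple hot games. For integers $a\ge b\ge c$, the simple hot game $\{\underline{a}\mid\underline{b}\mid\underline{c}\}$ is the game in which each player has exactly one move, with Left option $\underline a$, Right option $\underline c$ and same-round option $\underline b$. $\mathbb{CR}_{SH}\subset\mathbb{CR}$ is the class of all (finite) disjunctive sums of simple hot games and integers. Equivalence. $G\equiv H$ (modulo $\mathbb{CR}_{SH}$) if $o(G+X)=o(H+X)$ for all $X\in\mathbb{CR}_{SH}$. *)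

(* Defs.v *)
From mathcomp Require Import all_boot all_order all_algebra.

Set Implicit Arguments.
Unset Strict Implicit.
Unset Printing Implicit Defensive.

Import Order.TTheory GRing.Theory Num.Theory.

(** MathComp development of short Cheating Robot games. *)

(** [Game GL GR GS] is the position with [m] Left moves and [n] Right moves,
    Left options [GL i], Right options [GR j] and same-round options [GS i j].
    The matrix [GS] is empty exactly when [m = 0] or [n = 0]. *)
Inductive game : Type :=
  Game (m n : nat) (GL : 'I_m -> game) (GR : 'I_n -> game)
       (GS : 'I_m -> 'I_n -> game).

Definition no_move (T : Type) (i : 'I_0) : T :=
  False_rect T (notF (ltn_ord i)).

Definition game0 : game :=
  Game (@no_move game) (@no_move game) (fun i _ => no_move game i).

Inductive outcome : Type := LeftWins | Draw | RightWins.

(** In each round Right answers Left's announced move, hence the quantifier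
    order in the following two definitions. *)
Fixpoint left_forces_win (G : game) : bool :=
  let: @Game m n _ _ GS := G in
  if (m == 0) || (n == 0) then 0 < m
  else [exists i, forall j, left_forces_win (GS i j)].

Fixpoint right_forces_win (G : game) : bool :=
  let: @Game m n _ _ GS := G in
  if (m == 0) || (n == 0) then 0 < n
  else [forall i, exists j, right_forces_win (GS i j)].

Definition outcome_of (G : game) : outcome :=
  if left_forces_win G then LeftWins
  else if right_forces_win G then RightWins
  else Draw.

(** Moves of the sum are indexed by ['I_(m + p)]: the first [m] are moves in
    the first component, the last [p] are moves in the second one. *)
Fixpoint game_add (G : game) : game -> game :=
  fix game_addG (H : game) : game :=
    let: @Game m n GL GR GS := G in
    let: @Game p q HL HR HS := H in
    Game
      (fun i : 'I_(m + p) =>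
         match split i with
         | inl i => game_add (GL i) H
         | inr k => game_addG (HL k)
         end)
      (fun j : 'I_(n + q) =>
         match split j with
         | inl j => game_add (GR j) H
         | inr l => game_addG (HR l)
         end)
      (fun (i : 'I_(m + p)) (j : 'I_(n + q)) =>
         match split i, split j with
         | inl i, inl j => game_add (GS i j) H
         | inr k, inr l => game_addG (HS k l)
         | inl i, inr l => game_add (GL i) (HR l)
         | inr k, inl j => game_add (GR j) (HL k)
         end).

Fixpoint nat_game (n : nat) : game :=
  if n is k.+1 then
    Game (fun _ : 'I_1 => nat_game k) (@no_move game)
         (fun _ => @no_move game)
  else game0.

Fixpoint oppnat_game (n : nat) : game :=
  if n is k.+1 then
    Game (@no_move game) (fun _ : 'I_1 => oppnat_game k)
         (fun i _ => no_move game i)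
  else game0.

(** [Negz n] is the integer [- n.+1]. *)
Definition int_game (z : int) : game :=
  match z with
  | Posz n => nat_game n
  | Negz n => oppnat_game n.+1
  end.

Definition hot_game (a b c : int) : game :=
  Game (fun _ : 'I_1 => int_game a) (fun _ : 'I_1 => int_game c)
       (fun _ _ => int_game b).

(** All finite sums, with arbitrary bracketing; the empty sum is
    [int_game 0]. *)
Inductive CR_SH : game -> Prop :=
| CR_SH_int (n : int) : CR_SH (int_game n)
| CR_SH_hot (a b c : int) :
    (b <= a)%R -> (c <= b)%R -> CR_SH (hot_game a b c)
| CR_SH_add (G H : game) : CR_SH G -> CR_SH H -> CR_SH (game_add G H).

Definition equiv_mod (C : game -> Prop) (G H : game) : Prop :=
  forall X : game, C X ->
    outcome_of (game_add G X) = outcome_of (game_add H X).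

(* Main.v *)
Require Import Defs.
From mathcomp Require Import all_boot all_order all_algebra.
From mathcomp Require Import zify.

Set Implicit Arguments.
Unset Strict Implicit.
Unset Printing Implicit Defensive.

Import Order.TTheory GRing.Theory Num.Theory.

(** Why an integer behaves like a reserve of spare moves.

    In a sum of simple hot games and integers, the integers only provide
    moves that change nothing but the balance: a Left move costs Left one
    unit, a Right move gives one back.  Once all hot components are played,
    the sign of the balance decides the outcome.  So the claim is that the
    outcome depends only on the hot components still alive and on the total
    [d] of the integers; then [a + c] can be split between one or two
    components at will.

    The danger is that having an integer to move in is itself an asset: with
    [a = 1] and [c = -1] both players have a tempo move that [0] does not
    offer.  It is not, because tempo moves are dominated:
    - if Left plays in a hot game [{a | b | c}], Right does better to answer in
      the same game than with a tempo, since [b <= a + 1];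
    - if Left plays a tempo and Right has one too, Right's tempo cancels it;
    - if Left plays a tempo and Right has none, Right must answer in some hot
      game [{a | b | c}], which goes to [c].  Left could have played in that
      very game: an answer in the same place gives [b >= c], and an answer
      elsewhere gives Left at least as much, because turning a hot game into
      its Left option [a] never hurts Left ([secures_clear]).

    Hence the value of a position is that of the abstract game [secures], in
    which only hot components are played and the integers are merged into
    [d]; this is [left_securesE].  To apply it to actual trees of sums, the
    moves of such a sum are matched with its leaves ([rep_labels]): every
    hot game or integer has at most one move per player, so a move is the
    choice of a leaf.

    Winning for Left and avoiding a win for Right are the same game
    up to the status of a draw, so a boolean [draw_ok] treats both at once. *)

(** * Left's objective, with draws counted as success or not *)

Fixpoint left_secures (draw_ok : bool) (G : game) : bool :=
  let: @Game m n _ _ GS := G in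
  if (m == 0) || (n == 0) then (n == 0) && (draw_ok || (0 < m))
  else [exists i, forall j, left_secures draw_ok (GS i j)].

Lemma left_forces_winE G : left_forces_win G = left_secures false G.
Proof.
elim: G => m n GL _ GR _ GS IH /=.
case: ifP => [|_]; first by case: m {GL GS IH} => [|m] /=; lia.
by apply: eq_existsb => i; apply: eq_forallb => j; apply: IH.
Qed.

Lemma right_forces_winE G : right_forces_win G = ~~ left_secures true G.
Proof.
elim: G => m n GL _ GR _ GS IH /=.
case: ifP => [_|_]; first by rewrite andbT lt0n.
rewrite negb_exists; apply: eq_forallb => i.
by rewrite negb_forall; apply: eq_existsb => j; apply: IH.
Qed.

Local Open Scope ring_scope.

(** * The game on hot components only *)

Record hot := Hot {
  hot_left : int; hot_mid : int; hot_right : int;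
  hot_mid_le_left : hot_mid <= hot_left;
  hot_right_le_mid : hot_right <= hot_mid }.

(** Played components become [None] instead of being removed, so that the
    surviving ones keep their positions. *)
Definition clear (k : nat) (h : seq (option hot)) := set_nth None h k None.

Lemma nth_clear k h l :
  nth None (clear k h) l = if l == k then None else nth None h l.
Proof. by rewrite nth_set_nth. Qed.

Lemma clearC k l h : clear k (clear l h) = clear l (clear k h).
Proof.
have [->//|nekl] := eqVneq k l.
by rewrite /clear set_set_nth eq_sym (negPf nekl).
Qed.

Lemma clear_id k h : (k < size h)%N -> nth None h k = None -> clear k h = h.
Proof.
move=> ltk hk; apply: (@eq_from_nth _ None) => [|l _].
  by rewrite size_set_nth; apply/maxn_idPr.
by rewrite nth_clear; case: eqP => [->|].
Qed.

(** [secures draw_ok h d]: Left reaches her objective when only the hot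
    components listed in [h] are played, [d] being the sum of all integers.
    The two conditions of a round are Right's answers in the same component
    and in another one; integers are not available as moves. *)
Inductive secures (draw_ok : bool) : seq (option hot) -> int -> Prop :=
| SecuresEnd h d :
    (forall k, nth None h k = None) -> 0 < d ?<= if draw_ok ->
    secures draw_ok h d
| SecuresPlay h d k g :
    nth None h k = Some g ->
    secures draw_ok (clear k h) (d + hot_mid g) ->
    (forall l g', nth None (clear k h) l = Some g' ->
       secures draw_ok (clear l (clear k h)) (d + hot_left g + hot_right g')) ->
    secures draw_ok h d.

Lemma secures_mono dr h d d' : d <= d' -> secures dr h d -> secures dr h d'.
Proof.
move=> led sec; elim: sec d' led => {h d} [h d h0 d0 | h d k g hk _ IHb _ IHac] d' led.
  by apply: SecuresEnd => //; move: d0; case: (dr) => /=; lia.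
apply: SecuresPlay hk _ _ => [|l g' hl]; first by apply: IHb; lia.
by apply: IHac hl _ _; lia.
Qed.

(** Left may receive the Left option of a hot component for free: keep the
    same strategy, and where it would play in that component, note that the
    worst answer [b <= a] leads to a position at most as good as the one
    already reached. *)
Lemma secures_clear dr h d k g :
  secures dr h d -> nth None h k = Some g -> secures dr (clear k h) (d + hot_left g).
Proof.
move=> sec; elim: sec k g => {h d} [h d h0 _ | h d k' g' hk' sb IHb _ IHac] k g hk.
  by rewrite h0 in hk.
have [kk'|nkk'] := eqVneq k' k.
  subst k'; move: hk'; rewrite hk => -[eg]; subst g'.
  by apply: secures_mono sb; have := hot_mid_le_left g; lia.
apply: (@SecuresPlay _ _ _ k' g') => [||l g2].
- by rewrite nth_clear (negPf nkk').
- rewrite clearC (_ : _ + _ = d + hot_mid g' + hot_left g); last by lia.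
  by apply: IHb; rewrite nth_clear eq_sym (negPf nkk').
rewrite clearC nth_clear; case: eqP => // /eqP nlk hl; rewrite clearC.
rewrite (_ : _ + _ = d + hot_left g' + hot_right g2 + hot_left g); last by lia.
by apply: IHac => //; rewrite !nth_clear eq_sym (negPf nlk) eq_sym (negPf nkk').
Qed.

(** This absorbs the extra component in [a + c + X] compared with the single
    integer followed by [X]. *)
Lemma secures_consNone dr h d : secures dr (None :: h) d <-> secures dr h d.
Proof.
split=> sec.
  move eh': (None :: h) sec => h' sec.
  elim: sec h eh' => {h' d} [h' d h0 d0 | h' d k g hk _ IHb _ IHac] h eh'; subst h'.
    by apply: SecuresEnd d0 => k; have := h0 k.+1.
  case: k hk IHb IHac => // k hk IHb IHac.
  apply: (@SecuresPlay _ _ _ k g hk (IHb _ erefl)) => l g' hl.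
  exact: (IHac l.+1 g' hl _ erefl).
elim: sec => {h d} [h d h0 d0 | h d k g hk _ IHb _ IHac].
  by apply: SecuresEnd (d0) => -[|k] //=.
apply: (@SecuresPlay _ (None :: h) _ k.+1 g hk IHb) => -[|l] // g' hl.
exact: IHac hl.
Qed.

(** * Sums of hot games and integers, leaf by leaf *)

Inductive component := Int of int | Switch of hot.

Definition component0 := Int 0.

Definition game_of (x : component) : game :=
  match x with
  | Int z => int_game z
  | Switch g => hot_game (hot_left g) (hot_mid g) (hot_right g)
  end.

Definition hot_of (x : component) : option hot := if x is Switch g then Some g else None.

Definition value (x : component) : int := if x is Int z then z else 0.

Definition left_move (x : component) : option int :=
  match x with
  | Int z => if 0 < z then Some (z - 1) else None
  | Switch g => Some (hot_left g)
  end.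

Definition right_move (x : component) : option int :=
  match x with
  | Int z => if z < 0 then Some (z + 1) else None
  | Switch g => Some (hot_right g)
  end.

(** Two players never move in the same integer; the value on [Int] is a filler. *)
Definition both_move (x : component) : int :=
  if x is Switch g then hot_mid g else value x.

Definition set_int (s : seq component) (k : nat) (z : int) := set_nth component0 s k (Int z).

(** The leaves of a sum, read from left to right.  A move replaces the content
    of one leaf by an integer and preserves the bracketing, so the options of
    a represented game are represented too. *)
Inductive rep : seq component -> game -> Prop :=
| RepAtom x : rep [:: x] (game_of x)
| RepAdd s1 s2 G1 G2 :
    rep s1 G1 -> rep s2 G2 -> rep (s1 ++ s2) (game_add G1 G2).

(** [fL] and [fR] send each move to the leaf where it is made.  They are onto
    the leaves that offer a move, and a round with both players in the same leaf
    is told apart by [fL i == fR j]. *)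
Definition leaf_labels m n (GL : 'I_m -> game) (GR : 'I_n -> game)
    (GS : 'I_m -> 'I_n -> game) (s : seq component)
    (fL : 'I_m -> nat) (fR : 'I_n -> nat) : Prop :=
  [/\ forall k z, left_move (nth component0 s k) = Some z -> exists i, fL i = k,
      forall k z, right_move (nth component0 s k) = Some z -> exists j, fR j = k,
      forall i, exists2 x, left_move (nth component0 s (fL i)) = Some x &
        rep (set_int s (fL i) x) (GL i),
      forall j, exists2 y, right_move (nth component0 s (fR j)) = Some y &
        rep (set_int s (fR j) y) (GR j) &
      forall i j x y, left_move (nth component0 s (fL i)) = Some x ->
        right_move (nth component0 s (fR j)) = Some y ->
        rep (if fL i == fR j then set_int s (fL i) (both_move (nth component0 s (fL i)))
             else set_int (set_int s (fL i) x) (fR j) y) (GS i j)].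

Lemma left_move_size s k z : left_move (nth component0 s k) = Some z -> (k < size s)%N.
Proof. by case: ltnP => // le; rewrite nth_default. Qed.

Lemma right_move_size s k z : right_move (nth component0 s k) = Some z -> (k < size s)%N.
Proof. by case: ltnP => // le; rewrite nth_default. Qed.

Lemma size_set_int s k z : (k < size s)%N -> size (set_int s k z) = size s.
Proof. by move=> lt; rewrite size_set_nth; apply/maxn_idPr. Qed.

Lemma set_int_catl s1 s2 k z :
  (k < size s1)%N -> set_int (s1 ++ s2) k z = set_int s1 k z ++ s2.
Proof.
by elim: s1 k => // x s1 IH [|k] //= lt; congr (_ :: _); apply: IH.
Qed.

Lemma set_int_catr s1 s2 k z :
  set_int (s1 ++ s2) (size s1 + k) z = s1 ++ set_int s2 k z.
Proof. by elim: s1 => //= x s1 IH; congr (_ :: _); apply: IH. Qed.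

Lemma nth_catr s1 s2 k : nth component0 (s1 ++ s2) (size s1 + k) = nth component0 s2 k.
Proof. by rewrite nth_cat ltnNge leq_addr /= addKn. Qed.

Lemma nth_catl s1 s2 k : (k < size s1)%N -> nth component0 (s1 ++ s2) k = nth component0 s1 k.
Proof. by rewrite nth_cat => ->. Qed.

Lemma nth_singleton_move (mv : component -> option int) x k z :
  mv component0 = None -> mv (nth component0 [:: x] k) = Some z -> k = 0%N /\ mv x = Some z.
Proof. by move=> mv0; case: k => [|k] /=; rewrite ?nth_nil ?mv0. Qed.

Lemma rep_labels s G : rep s G ->
  let: @Game m n GL GR GS := G in exists fL fR, @leaf_labels m n GL GR GS s fL fR.
Proof.
elim=> {s G} [[z|g]|s1 s2 G1 G2].
- case: z => [[|n]|n] /=; exists (fun=> 0%N), (fun=> 0%N).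
  + by split=> [k z|k z|[]|[]|[]] //; case/nth_singleton_move.
  + split=> [k z|k z|i|[]|i []] //; try by case/nth_singleton_move => // ->; exists ord0.
    exists (Posz n) => /=; first by congr Some; lia.
    exact: RepAtom.
  + split=> [k z|k z|[]|j|[]] //; try by case/nth_singleton_move => // ->; exists ord0.
    exists (- n%:Z) => /=; first by congr Some; lia.
    have -> : oppnat_game n = game_of (Int (- n%:Z)) by case: (n).
    exact: RepAtom.
- exists (fun=> 0%N), (fun=> 0%N); split=> [k z|k z|i|j|i j x y].
  + by case/nth_singleton_move => // ->; exists ord0.
  + by case/nth_singleton_move => // ->; exists ord0.
  + by exists (hot_left g) => //; apply: (RepAtom (Int _)).
  + by exists (hot_right g) => //; apply: (RepAtom (Int _)).
  + by move=> _ _; apply: (RepAtom (Int _)).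
case: G1 => m n GL GR GS; case: G2 => p q HL HR HS.
move=> r1 [fL [fR [cL cR oL oR oS]]] r2 [eL [eR [dL dR uL uR uS]]] /=.
exists (fun i => match split i with inl i => fL i | inr k => size s1 + eL k end)%N.
exists (fun i => match split i with inl i => fR i | inr k => size s1 + eR k end)%N.
split.
- move=> k z; case: (ltnP k (size s1)) => lk.
    rewrite nth_catl // => /cL [i <-]; exists (lshift p i).
    by rewrite (unsplitK (inl i)).
  rewrite -(subnKC lk) nth_catr => /dL [i <-]; exists (rshift m i).
  by rewrite (unsplitK (inr i)).
- move=> k z; case: (ltnP k (size s1)) => lk.
    rewrite nth_catl // => /cR [i <-]; exists (lshift q i).
    by rewrite (unsplitK (inl i)).
  rewrite -(subnKC lk) nth_catr => /dR [i <-]; exists (rshift n i).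
  by rewrite (unsplitK (inr i)).
- move=> i; case: (split i) => {}i.
    have [x ex rx] := oL i; exists x; rewrite ?nth_catl ?set_int_catl ?(left_move_size ex) //.
    exact: RepAdd rx r2.
  have [x ex rx] := uL i; exists x; rewrite ?nth_catr ?set_int_catr //.
  exact: RepAdd r1 rx.
- move=> i; case: (split i) => {}i.
    have [x ex rx] := oR i; exists x; rewrite ?nth_catl ?set_int_catl ?(right_move_size ex) //.
    exact: RepAdd rx r2.
  have [x ex rx] := uR i; exists x; rewrite ?nth_catr ?set_int_catr //.
  exact: RepAdd r1 rx.
move=> i j x y; case: (split i) => {}i; case: (split j) => {}j.
- have [x' /left_move_size li _] := oL i; have [y' /right_move_size lj _] := oR j.
  rewrite !nth_catl // => ex ey; have := oS i j x y ex ey.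
  case: eqP => _ r; rewrite !set_int_catl ?size_set_int //; exact: RepAdd r r2.
- have [x' ex' rx] := oL i; have [y' ey' ry] := uR j; have li := left_move_size ex'.
  rewrite (nth_catl _ li) nth_catr ex' ey' => -[<-] [<-].
  rewrite ifN; last by apply/eqP; lia.
  rewrite set_int_catl // -(size_set_int x' li) set_int_catr; exact: RepAdd rx ry.
- have [x' ex' rx] := uL i; have [y' ey' ry] := oR j; have lj := right_move_size ey'.
  rewrite (nth_catl _ lj) nth_catr ex' ey' => -[<-] [<-].
  rewrite ifN; last by apply/eqP; lia.
  rewrite set_int_catr set_int_catl //; exact: RepAdd ry rx.
- rewrite !nth_catr eqn_add2l => ex ey; have := uS i j x y ex ey.
  case: eqP => _ r; rewrite !set_int_catr; exact: RepAdd r1 r.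
Qed.

(** * The hot components and the total determine the outcome *)

Definition hots (s : seq component) := [seq hot_of x | x <- s].

Definition total (s : seq component) : int := \sum_(x <- s) value x.

Lemma nth_hots s k : nth None (hots s) k = hot_of (nth component0 s k).
Proof.
case: (ltnP k (size s)) => lk; first exact: nth_map.
by rewrite !nth_default ?size_map.
Qed.

Lemma hots_set_int s k z : hots (set_int s k z) = clear k (hots s).
Proof.
apply: (@eq_from_nth _ None) => [|l _].
  by rewrite size_map !size_set_nth size_map.
by rewrite nth_clear !nth_hots nth_set_nth /=; case: eqP.
Qed.

Lemma total_set_int s k z :
  total (set_int s k z) = total s - value (nth component0 s k) + z.
Proof.
rewrite /total; elim: s k => [|x s IH] [|k].
- by rewrite /set_int /= !big_cons big_nil /=; lia.
- rewrite nth_nil big_nil /set_int set_nth_nil.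
  by elim: k => [|k] /=; rewrite !big_cons ?big_nil /=; lia.
- by rewrite /set_int /= !big_cons /=; lia.
- by move: (IH k); rewrite /set_int /= !big_cons => ->; lia.
Qed.

Lemma left_move_int x z :
  hot_of x = None -> left_move x = Some z -> 0 < value x /\ z = value x - 1.
Proof. by case: x => //= y _; case: ifP => // ? [<-]. Qed.

Lemma right_move_int x z :
  hot_of x = None -> right_move x = Some z -> value x < 0 /\ z = value x + 1.
Proof. by case: x => //= y _; case: ifP => // ? [<-]. Qed.

Lemma total_le0 s : (forall k, left_move (nth component0 s k) = None) -> total s <= 0.
Proof.
rewrite /total; elim: s => [|x s IH] none; first by rewrite big_nil.
rewrite big_cons; have := IH (fun k => none k.+1); have := none 0%N.
by case: x {none} => //= z; case: ifP => //; lia.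
Qed.

Lemma total_ge0 s : (forall k, right_move (nth component0 s k) = None) -> 0 <= total s.
Proof.
rewrite /total; elim: s => [|x s IH] none; first by rewrite big_nil.
rewrite big_cons; have := IH (fun k => none k.+1); have := none 0%N.
by case: x {none} => //= z; case: ifP => //; lia.
Qed.

Lemma total_gt0 s k z : (forall k, right_move (nth component0 s k) = None) ->
  left_move (nth component0 s k) = Some z -> 0 < total s.
Proof.
rewrite /total; elim: s k => [|x s IH] [|k] none //=; try by rewrite nth_nil.
  have := @total_ge0 s (fun k => none k.+1); rewrite /total big_cons.
  by have := none 0%N; case: x {none} => //= y _; case: ifP => //; lia.
move=> /(IH _ (fun k => none k.+1)); have := none 0%N; rewrite big_cons.
by case: x {none} => //= y; case: ifP => //; lia.
Qed.
Lemma total_lt0 s k z : (forall k, left_move (nth component0 s k) = None) ->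
  right_move (nth component0 s k) = Some z -> total s < 0.
Proof.
rewrite /total; elim: s k => [|x s IH] [|k] none //=; try by rewrite nth_nil.
  have := @total_le0 s (fun k => none k.+1); rewrite /total big_cons.
  by have := none 0%N; case: x {none} => //= y _; case: ifP => //; lia.
move=> /(IH _ (fun k => none k.+1)); have := none 0%N; rewrite big_cons.
by case: x {none} => //= y; case: ifP => //; lia.
Qed.

Lemma secures_nohot dr h d : (forall k, nth None h k = None) ->
  secures dr h d -> 0 < d ?<= if dr.
Proof. by move=> h0 sec; case: sec h0 => // h' d' k g hk _ _ h0; rewrite h0 in hk. Qed.


(** Tempo moves in integers are irrelevant, by induction on the game tree.
    When Left wins by a tempo that Right can return, the next position has the
    same hot components and total.  When Right cannot return it, every hot
    component is a possible answer, and Left may instead open in any of them,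
    by [secures_clear].  Conversely a strategy on the hot components also
    beats tempo answers, each being worse for Right than an answer in
    the component just played. *)
Lemma left_securesE dr s G :
  rep s G -> left_secures dr G <-> secures dr (hots s) (total s).
Proof.
elim: G s => m n GL _ GR _ GS IH s /rep_labels [fL [fR [cL cR oL oR oS]]].
have hot_move k g : nth None (hots s) k = Some g ->
    nth component0 s k = Switch g /\ (exists i, fL i = k) /\ (exists j, fR j = k).
  rewrite nth_hots; case e: (nth component0 s k) => [//|g'] [eg]; subst g'.
  by split=> //; split; [apply: cL | apply: cR]; rewrite e.
rewrite /=; case: ifP => [mn0|mn].
  have nohot k : nth None (hots s) k = None.
    case e: (nth _ _ k) => [g|//]; have [_ [[i _] [j _]]] := hot_move _ _ e.
    by case/orP: mn0 => /eqP ?; subst; [case: i | case: j].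
  have secE : secures dr (hots s) (total s) <-> 0 < total s ?<= if dr.
    by split; [apply: secures_nohot | apply: SecuresEnd].
  have noL : m = 0%N -> forall k, left_move (nth component0 s k) = None.
    by move=> m0 k; case e: left_move => [z|//]; have [i _] := cL _ _ e; subst m; case: i.
  have noR : n = 0%N -> forall k, right_move (nth component0 s k) = None.
    by move=> n0 k; case e: right_move => [z|//]; have [i _] := cR _ _ e; subst n; case: i.
  rewrite secE; have [n0|npos] := posnP n.
    have [m0|mpos] := posnP m.
      have := total_le0 (noL m0); have := total_ge0 (noR n0).
      by case: (dr) => /=; split; lia.
    have [x ex _] := oL (Ordinal mpos); have := total_gt0 (noR n0) ex.
    by case: (dr) => /=; split; lia.
  have m0 : m = 0%N by lia.
  have [y ey _] := oR (Ordinal npos); have := total_lt0 (noL m0) ey.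
  by case: (dr) => /=; split; lia.
have same i j g : nth component0 s (fL i) = Switch g -> fR j = fL i ->
    left_secures dr (GS i j) <->
    secures dr (clear (fL i) (hots s)) (total s + hot_mid g).
  move=> e ej; have [x ex _] := oL i; have [y ey _] := oR j.
  have := oS i j _ _ ex ey; rewrite ej eqxx e /= => /IH ->.
  rewrite hots_set_int total_set_int e /=.
  by rewrite (_ : _ - 0 + _ = total s + hot_mid g) //; lia.
have other i j x y : fR j != fL i ->
    left_move (nth component0 s (fL i)) = Some x ->
    right_move (nth component0 s (fR j)) = Some y ->
    left_secures dr (GS i j) <->
    secures dr (hots (set_int (set_int s (fL i) x) (fR j) y))
      (total s + (x - value (nth component0 s (fL i))) + (y - value (nth component0 s (fR j)))).
  move=> ne ex ey; have := oS i j _ _ ex ey; rewrite eq_sym (negPf ne) => /IH ->.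
  rewrite !total_set_int nth_set_nth /= (negPf ne).
  by rewrite (_ : _ - _ + _ - _ + _ = total s + (x - value (nth component0 s (fL i))) + (y - value (nth component0 s (fR j)))) //; lia.
have hot_replies i k g l g' : fL i = k -> nth component0 s k = Switch g ->
    (forall j, left_secures dr (GS i j)) -> nth None (clear k (hots s)) l = Some g' ->
    secures dr (clear l (clear k (hots s))) (total s + hot_left g + hot_right g').
  move=> ei e win; rewrite nth_clear; case: eqP => // /eqP nlk hl.
  have [el [_ [j ej]]] := hot_move _ _ hl.
  have := win j; rewrite other ?ei ?ej ?e ?el //= !hots_set_int.
  by apply: secures_mono; lia.
split.
  case/existsP=> i /forallP win; have [x ex _] := oL i; have ltL := left_move_size ex.
  case e: (nth component0 s (fL i)) => [z|g]; last first.
    apply: (@SecuresPlay _ _ _ (fL i) g); first by rewrite nth_hots e.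
      have [j ej] : exists j, fR j = fL i by apply: cR; rewrite e.
      by have := win j; rewrite (same _ _ _ e ej).
    by move=> l g' hl; apply: hot_replies hl.
  have [z0 xE] : 0 < z /\ x = z - 1 by have := left_move_int _ ex; rewrite e; apply.
  (* Left's move is a tempo: look for an integer in which Right can return it. *)
  have [j hj|allhot] := pickP (fun j => ~~ isSome (nth None (hots s) (fR j))).
    have [y ey _] := oR j; have ltR := right_move_size ey.
    have hj0 : hot_of (nth component0 s (fR j)) = None by move: hj; rewrite nth_hots; case: hot_of.
    have [yv yE] := right_move_int hj0 ey.
    have ne : fR j != fL i by apply: contraTneq yv => ->; rewrite e /=; lia.
    have := win j; rewrite (other _ _ _ _ ne ex ey) !hots_set_int.
    rewrite (clear_id (k := fL i)) ?size_map ?nth_hots ?e //.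
    rewrite clear_id ?size_map ?nth_hots //.
    by apply: secures_mono; rewrite yE /=; lia.
  (* No integer is available to Right: all his answers to the tempo are hot,
     and any of these components can serve as Left's opening move. *)
  have reply l g : nth None (hots s) l = Some g ->
      secures dr (clear l (hots s)) (total s - 1 + hot_right g).
    move=> hl; have [el [_ [j ej]]] := hot_move _ _ hl.
    have ne : fR j != fL i by apply/eqP => eji; rewrite -eji ej el in e.
    have := win j; rewrite (other _ _ _ (hot_right g) ne ex); last by rewrite ej el.
    rewrite !hots_set_int (clear_id (k := fL i)) ?size_map ?nth_hots ?e // ej el /=.
    by apply: secures_mono; lia.
  have npos : (0 < n)%N by lia.
  have := allhot (Ordinal npos); case hl: (nth _ _ _) => [g|//] _.
  apply: SecuresPlay (hl) _ _ => [|l g'].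
    apply: secures_mono (reply _ _ hl); have := hot_right_le_mid g; lia.
  rewrite nth_clear; case: eqP => // /eqP nl hl'; rewrite clearC.
  apply: (@secures_mono _ _ (total s - 1 + hot_right g' + hot_left g)); first by lia.
  by apply: secures_clear (reply _ _ hl') _; rewrite nth_clear eq_sym (negPf nl).
have [mpos npos] : (0 < m)%N /\ (0 < n)%N by lia.
move eh: (hots s) => h; move ed: (total s) => d sec.
case: sec eh ed => {h d} [h d h0 d0|h d k g hk sb sac] eh ed; subst h d.
  (* Only integers are left, so every round is an exchange of tempi. *)
  apply/existsP; exists (Ordinal mpos); apply/forallP => j.
  have nohot k : hot_of (nth component0 s k) = None by rewrite -nth_hots.
  have [x ex _] := oL (Ordinal mpos); have ltL := left_move_size ex.
  have [y ey _] := oR j; have ltR := right_move_size ey.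
  have [xv xE] := left_move_int (nohot _) ex.
  have [yv yE] := right_move_int (nohot _) ey.
  have ne : fR j != fL (Ordinal mpos) by apply: contraTneq yv => ->; lia.
  rewrite (other _ _ _ _ ne ex ey) !hots_set_int.
  rewrite (clear_id (k := fL _)) ?size_map ?nth_hots // clear_id ?size_map ?nth_hots //.
  by apply: SecuresEnd h0 _; rewrite xE yE; move: d0; case: (dr) => /=; lia.
have [e [[i ei] _]] := hot_move _ _ hk; subst k.
apply/existsP; exists i; apply/forallP => j.
have [x ex _] := oL i; have [y ey _] := oR j; have ltR := right_move_size ey.
have [ej|ne] := eqVneq (fR j) (fL i); first by rewrite (same _ _ _ e ej).
have xE : x = hot_left g by move: ex; rewrite e => -[].
rewrite (other _ _ _ _ ne ex ey) !hots_set_int.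
case ej: (nth component0 s (fR j)) => [z|g'].
  have [|yv yE] := right_move_int _ ey; first by rewrite ej.
  rewrite clear_id ?nth_clear ?(negPf ne) ?nth_hots ?ej //; last first.
    by rewrite -(hots_set_int _ _ x) size_map size_set_int // (left_move_size ex).
  by apply: secures_mono sb; rewrite e yE ej xE /=; have := hot_mid_le_left g; lia.
have yE : y = hot_right g' by move: ey; rewrite ej => -[].
rewrite xE yE e /= !subr0; apply: sac.
by rewrite nth_clear (negPf ne) nth_hots ej.
Qed.

Lemma CR_SH_rep X : CR_SH X -> exists s, rep s X.
Proof.
elim=> [n|a b c ba cb|G H _ [s1 r1] _ [s2 r2]].
- by exists [:: Int n]; apply: RepAtom.
- by exists [:: Switch (Hot ba cb)]; apply: RepAtom.
- by exists (s1 ++ s2); apply: RepAdd.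
Qed.

Theorem lemma6 (a c : int) :
  equiv_mod CR_SH (game_add (int_game a) (int_game c)) (int_game (a + c)%R).
Proof.
move=> X /CR_SH_rep [s rX].
have same dr : left_secures dr (game_add (game_add (int_game a) (int_game c)) X)
             = left_secures dr (game_add (int_game (a + c)) X).
  have := left_securesE dr (RepAdd (RepAtom (Int (a + c))) rX).
  have := left_securesE dr (RepAdd (RepAdd (RepAtom (Int a)) (RepAtom (Int c))) rX).
  rewrite /= !secures_consNone /total !big_cons /= addrA => eq2 eq1.
  by apply/idP/idP; rewrite eq1 eq2.
by rewrite /outcome_of !right_forces_winE !left_forces_winE !same.
Qed.
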